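(* Let $k,s,p,q\in\mathbb{Z}$ and let $\alpha,\beta,\gamma,\eta:\mathbb{Z}\to\mathbb{Z}$, written $i\mapsto\alpha_i,\beta_i,\gamma_i,\eta_i$, be integer families such that for all $f,g\in\{\alpha,\beta,\gamma,\eta\}$ the sum $f_i+g_j$ depends only on $i+j$; write $(f+g)_{i+j}=f_i+g_j$. Then for all integers $m,n\ge2$ the following identity holds in $U(\bar{\mathcal{L}})$: \[ \begin{aligned} &\sum_{\substack{0\le i\le m\\ 0\le j\le n}}(-1)^{i+j}\binom{m}{i}\binom{n}{j}\Bigl(\bigl[\Omega^{(m)}_{k-i,s-j,\alpha,\beta},\Omega^{(n)}_{q+i,p+j,\gamma,\eta}\bigr]_+-\bigl[\Omega^{(m)}_{k-i,q-j,\alpha,\gamma},\Omega^{(n)}_{s+i,p+j,\beta,\eta}\bigr]_+\Bigr)\\ &=(q-s)\Bigl((p-k+2n)\,\Omega^{(2(m+n)-1)}_{k+p+2n,\,s+q-2n,\,\alpha+\eta,\,\beta+\gamma}-(p-k+2m)\,\Omega^{(2(m+n)-1)}_{k+p+2n-1,\,s+q-2n+1,\,\alpha+\eta,\,\beta+\gamma}\Bigr). \end{aligned} \]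
   Context: Everything is over $\mathbb{C}$. $\bar{\mathcal{L}}$ is the centerless loop mirror Heisenberg-Virasoro algebra: it has basis $\{L_{m,i},H_{r,i}\mid m,i\in\mathbb{Z},\ r\in\mathbb{Z}+\frac12\}$ and brackets $[L_{m,i},L_{n,j}]=(m-n)L_{m+n,i+j}$, $[L_{m,i},H_{r,j}]=-rH_{m+r,i+j}$, $[H_{r,i},H_{s,j}]=0$. $U(\bar{\mathcal{L}})$ is its universal enveloping algebra, and $[X,Y]_+=XY+YX$. For $l\in\mathbb{N}$ (nonnegative integers), $k,s\in\mathbb{Z}$ and integer families $\alpha=(\alpha_i)_{i\in\mathbb{Z}}$, $\beta=(\beta_i)_{i\in\mathbb{Z}}$ put \[ \Omega^{(l)}_{k,s,\alpha,\beta}=\sum_{i=0}^{l}(-1)^i\binom{l}{i}L_{k-i,\alpha_{k-i}}L_{s+i,\beta_{s+i}}\in U(\bar{\mathcal{L}}). \] The families $\alpha+\eta$ and $\beta+\gamma$ are those given by $(\alpha+\eta)_{i+j}=\alpha_i+\eta_j$ and $(\beta+\gamma)_{i+j}=\beta_i+\gamma_j$. *)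

(* Defs.v *)
From HB Require Import structures.
From mathcomp Require Import all_boot all_order all_algebra.
From mathcomp Require Import generic_quotient ring_quotient.
From mathcomp Require Import finmap monalg.
From mathcomp Require Import boolp reals complex.

Set Implicit Arguments.
Unset Strict Implicit.
Unset Printing Implicit Defensive.

Import GRing.Theory.
Local Open Scope ring_scope.
Local Open Scope quotient_scope.

Fact quot_key : unit. Proof. exact: tt. Qed.

(* ring_quotient only makes quotients of commutative rings into rings; this is
   the quotient of a noncommutative algebra by the two-sided ideal that a set
   generates, provided that this ideal is proper. *)
Section AlgebraQuotient.
Context (K : fieldType) (A : algType K).

Inductive ideal_gen (G : A -> Prop) : A -> Prop :=
| ideal_gen_in u : G u -> ideal_gen G u
| ideal_gen0 : ideal_gen G 0
| ideal_genB u v : ideal_gen G u -> ideal_gen G v -> ideal_gen G (u - v)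
| ideal_genMl w u : ideal_gen G u -> ideal_gen G (w * u)
| ideal_genMr w u : ideal_gen G u -> ideal_gen G (u * w).

Lemma ideal_gen_proper (G : A -> Prop) (e : {rmorphism A -> K}) :
  (forall u, G u -> e u = 0) -> ~ ideal_gen G 1.
Proof.
move=> eG; suff h u : ideal_gen G u -> e u = 0.
  by move/h/eqP; rewrite rmorph1 oner_eq0.
elim=> [v /eG//||v w _ hv _ hw|w v _ hv|w v _ hv].
- exact: rmorph0.
- by rewrite rmorphB /= hv hw subr0.
- by rewrite rmorphM /= hv mulr0.
- by rewrite rmorphM /= hv mul0r.
Qed.

Context (G : A -> Prop).

Definition ideal_pred : {pred A} := fun u => `[< ideal_gen G u >].

Lemma ideal_predP u : reflect (ideal_gen G u) (u \in ideal_pred).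
Proof. exact: asboolP. Qed.

Lemma ideal_zmod_closed : zmod_closed ideal_pred.
Proof.
split; first exact/ideal_predP/ideal_gen0.
by move=> u v /ideal_predP hu /ideal_predP hv; apply/ideal_predP/ideal_genB.
Qed.

HB.instance Definition _ :=
  GRing.isZmodClosed.Build A ideal_pred ideal_zmod_closed.

Definition alg_quot (proper : ~ ideal_gen G 1) : Type :=
  Quotient.quot ideal_pred.

Context (proper : ~ ideal_gen G 1).
Local Notation Q := (alg_quot proper).

HB.instance Definition _ := GRing.Zmodule.on Q.

Definition quot_pi (u : A) : Q := \pi_(Quotient.quot ideal_pred) u.
Definition quot_repr (x : Q) : A := repr (x : Quotient.quot ideal_pred).

Lemma quot_reprK x : quot_pi (quot_repr x) = x.
Proof. exact: reprK. Qed.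

Lemma quot_pi_eq u v : quot_pi u = quot_pi v <-> ideal_gen G (u - v).
Proof.
split=> [/eqP|h].
  by rewrite /quot_pi -Quotient.idealrBE => /ideal_predP.
by apply/eqP; rewrite /quot_pi -Quotient.idealrBE; apply/ideal_predP.
Qed.

Lemma quot_pi_is_zmod_morphism : zmod_morphism quot_pi.
Proof. by move=> u v; rewrite /quot_pi raddfB. Qed.

HB.instance Definition _ :=
  GRing.isZmodMorphism.Build A Q quot_pi quot_pi_is_zmod_morphism.

Lemma quot_repr_pi u : ideal_gen G (quot_repr (quot_pi u) - u).
Proof. by apply/quot_pi_eq; rewrite quot_reprK. Qed.

(* The operations are locked, as unification otherwise unfolds them. *)
Definition quot_mul : Q -> Q -> Q :=
  locked_with quot_key (fun x y => quot_pi (quot_repr x * quot_repr y)).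
Definition quot_scale : K -> Q -> Q :=
  locked_with quot_key (fun c x => quot_pi (c *: quot_repr x)).

Lemma quot_mul_pi u v : quot_mul (quot_pi u) (quot_pi v) = quot_pi (u * v).
Proof.
rewrite /quot_mul unlock; apply/quot_pi_eq.
set u' := quot_repr _; set v' := quot_repr _.
rewrite (_ : u' * v' - u * v = (u' - u) * v' - u * (v - v')); last first.
  by rewrite mulrBl mulrBr opprB addrA subrK.
apply: ideal_genB; first exact/ideal_genMr/quot_repr_pi.
by apply/ideal_genMl/quot_pi_eq; rewrite quot_reprK.
Qed.

Lemma quot_scale_pi c u : quot_scale c (quot_pi u) = quot_pi (c *: u).
Proof.
rewrite /quot_scale unlock; apply/quot_pi_eq; rewrite -scalerBr -[_ - u]mul1r scalerAl.
exact/ideal_genMl/quot_repr_pi.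
Qed.

Lemma quot_mulA : associative quot_mul.
Proof.
move=> x y z; rewrite -[x]quot_reprK -[y]quot_reprK -[z]quot_reprK.
by rewrite !quot_mul_pi mulrA.
Qed.

Lemma quot_mul1r : left_id (quot_pi 1) quot_mul.
Proof. by move=> x; rewrite -[x]quot_reprK quot_mul_pi mul1r. Qed.

Lemma quot_mulr1 : right_id (quot_pi 1) quot_mul.
Proof. by move=> x; rewrite -[x]quot_reprK quot_mul_pi mulr1. Qed.

Lemma quot_mulDl : left_distributive quot_mul +%R.
Proof.
move=> x y z; rewrite -[x]quot_reprK -[y]quot_reprK -[z]quot_reprK.
by rewrite -raddfD /= !quot_mul_pi -raddfD /= mulrDl.
Qed.

Lemma quot_mulDr : right_distributive quot_mul +%R.
Proof.
move=> x y z; rewrite -[x]quot_reprK -[y]quot_reprK -[z]quot_reprK.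
by rewrite -raddfD /= !quot_mul_pi -raddfD /= mulrDr.
Qed.

Lemma quot_one_neq0 : quot_pi 1 != 0.
Proof.
apply/eqP; rewrite -(raddf0 quot_pi) => /quot_pi_eq.
by rewrite subr0.
Qed.

HB.instance Definition _ := GRing.Zmodule_isNzRing.Build Q
  quot_mulA quot_mul1r quot_mulr1 quot_mulDl quot_mulDr quot_one_neq0.

Lemma quot_scaleA a b x : quot_scale a (quot_scale b x) = quot_scale (a * b) x.
Proof. by rewrite -[x]quot_reprK !quot_scale_pi scalerA. Qed.

Lemma quot_scale1 : left_id 1 quot_scale.
Proof. by move=> x; rewrite -[x]quot_reprK quot_scale_pi scale1r. Qed.

Lemma quot_scaleDr : right_distributive quot_scale +%R.
Proof.
move=> c x y; rewrite -[x]quot_reprK -[y]quot_reprK.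
by rewrite -raddfD /= !quot_scale_pi -raddfD /= scalerDr.
Qed.

Lemma quot_scaleDl x : {morph quot_scale^~ x : a b / a + b}.
Proof.
by move=> a b; rewrite -[x]quot_reprK !quot_scale_pi -raddfD /= scalerDl.
Qed.

HB.instance Definition _ := GRing.Zmodule_isLmodule.Build K Q
  quot_scaleA quot_scale1 quot_scaleDr quot_scaleDl.

Lemma quot_piM u v : quot_pi (u * v) = quot_pi u * quot_pi v.
Proof. by rewrite -quot_mul_pi. Qed.

Lemma quot_piZ c u : quot_pi (c *: u) = c *: quot_pi u.
Proof. by rewrite -quot_scale_pi. Qed.

Lemma quot_scaleAl (c : K) (x y : Q) : c *: (x * y) = c *: x * y.
Proof.
rewrite -[x]quot_reprK -[y]quot_reprK.
by rewrite -quot_piM -!quot_piZ -quot_piM scalerAl.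
Qed.

HB.instance Definition _ := GRing.Lmodule_isLalgebra.Build K Q quot_scaleAl.

Lemma quot_scaleAr (c : K) (x y : Q) : c *: (x * y) = x * (c *: y).
Proof.
rewrite -[x]quot_reprK -[y]quot_reprK.
by rewrite -quot_piM -!quot_piZ -quot_piM scalerAr.
Qed.

HB.instance Definition _ := GRing.Lalgebra_isAlgebra.Build K Q quot_scaleAr.

HB.instance Definition _ := GRing.isMonoidMorphism.Build A Q quot_pi
  (erefl, quot_piM).
HB.instance Definition _ := GRing.isScalable.Build K A Q *:%R quot_pi quot_piZ.

End AlgebraQuotient.

Section MonoidAlgebra.
Context (K : fieldType) (M : monomType).

Definition monoid_alg : Type := {malg K[M]}.
HB.instance Definition _ := GRing.Lalgebra.on monoid_alg.

Lemma monoid_alg_scaleAr (c : K) (u v : {malg K[M]}) :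
  c *: (u * v) = u * (c *: v).
Proof.
suff cC : u * c%:MP = c%:MP * u by rewrite -!mul_malgC mulrA -cC mulrA.
rewrite [RHS]mul_malgC malgM_def fgmulgU malgZ_def /fgscale.
by apply: eq_bigr => k _; rewrite mulm1 mulrC.
Qed.

HB.instance Definition _ :=
  GRing.Lalgebra_isAlgebra.Build K monoid_alg monoid_alg_scaleAr.

Definition monoid_const (u : monoid_alg) : K := mcoeff (@mone M) u.

HB.instance Definition _ := GRing.isZmodMorphism.Build monoid_alg K monoid_const
  (@mcoeff_is_additive M K mone).
HB.instance Definition _ := GRing.isMonoidMorphism.Build monoid_alg K
  monoid_const
  (let: (eM, e1) := @mcoeff1g_is_multiplicative M K in (e1, eM)).

End MonoidAlgebra.

(* The universal enveloping algebra U(L) of a Lie algebra L over K that is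
   given by a basis B and by the brackets [brk a b] of the basis elements.
   L is {malg K[B]}, the free K-module on B.  The tensor algebra T(L) is
   the free associative unital algebra on B, i.e. the algebra of the free
   monoid {fmonom B}. *)
Section Enveloping.
Context (K : fieldType) (B : choiceType) (brk : B -> B -> {malg K[B]}).

Definition lie_bracket (x y : {malg K[B]}) : {malg K[B]} :=
  \sum_(a <- msupp x) \sum_(b <- msupp y) (x@_a * y@_b) *: brk a b.

Definition tens_alg : Type := monoid_alg K (fmonom B).
HB.instance Definition _ := GRing.Algebra.on tens_alg.

Definition tens_gen (a : B) : tens_alg := << fmu a >>.

Definition tens_inj (x : {malg K[B]}) : tens_alg :=
  \sum_(a <- msupp x) x@_a *: tens_gen a.

Definition env_rel (u : tens_alg) : Prop :=
  exists x y : {malg K[B]},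
    u = tens_inj x * tens_inj y - tens_inj y * tens_inj x
        - tens_inj (lie_bracket x y).

Lemma tens_inj_const x : monoid_const (tens_inj x) = 0.
Proof.
rewrite /tens_inj raddf_sum big1 //= => a _.
rewrite /monoid_const mcoeffZ mcoeffU.
case: eqP => [|_]; last by rewrite mulr0.
by move/(congr1 (@fmonom_val B)); rewrite fm1 fmuE.
Qed.

Lemma env_proper : ~ ideal_gen env_rel 1.
Proof.
have rel0 (A : algType K) (e : {rmorphism A -> K}) (u v w : A) :
    e u = 0 -> e v = 0 -> e w = 0 -> e (u * v - v * u - w) = 0.
  by move=> eu ev ew; rewrite !rmorphB !rmorphM /= eu ev ew mul0r !subr0.
apply: (@ideal_gen_proper K tens_alg env_rel (@monoid_const K (fmonom B))).
by move=> _ [x [y ->]]; apply: rel0; apply: tens_inj_const.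
Qed.

Definition env : Type := alg_quot env_proper.
HB.instance Definition _ := GRing.Algebra.on env.

(* The canonical linear map L -> U(L). *)
Definition env_inj : {malg K[B]} -> env :=
  locked_with quot_key (fun x => quot_pi env_proper (tens_inj x)).

Lemma env_inj_bracket x y :
  env_inj x * env_inj y - env_inj y * env_inj x = env_inj (lie_bracket x y).
Proof.
rewrite /env_inj unlock -!quot_piM -!raddfB.
by apply/quot_pi_eq/ideal_gen_in; exists x, y.
Qed.

Lemma lie_bracketU (a b : B) : lie_bracket << a >> << b >> = brk a b.
Proof.
rewrite /lie_bracket !msuppU oner_eq0 !big_seq_fset1 !mcoeffUU.
by rewrite mulr1 scale1r.
Qed.

Lemma env_injU (c : K) (a : B) :
  env_inj << c *g a >> = c *: env_inj << a >>.
Proof.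
have tensU d : tens_inj << d *g a >> = d *: tens_gen a.
  rewrite /tens_inj msuppU; case: eqP => [->|_].
    by rewrite big_seq_fset0 scale0r.
  by rewrite big_seq_fset1 mcoeffUU.
by rewrite /env_inj unlock !tensU scale1r quot_piZ.
Qed.

End Enveloping.

(* LMHV is the centerless loop mirror Heisenberg-Virasoro algebra.
   [LMHV_H a i] stands for H_{a + 1/2, i}: half-integers r are encoded by the
   integer r - 1/2. *)
Inductive LMHV_basis := LMHV_L of int & int | LMHV_H of int & int.

Definition LMHV_basis_code (x : LMHV_basis) : (int * int) + (int * int) :=
  match x with LMHV_L m i => inl (m, i) | LMHV_H a i => inr (a, i) end.

Definition LMHV_basis_decode (x : (int * int) + (int * int)) : LMHV_basis :=
  match x with inl (m, i) => LMHV_L m i | inr (a, i) => LMHV_H a i end.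

Lemma LMHV_basis_codeK : cancel LMHV_basis_code LMHV_basis_decode.
Proof. by case. Qed.

HB.instance Definition _ := Countable.copy LMHV_basis
  (can_type LMHV_basis_codeK).

Section LMHV.
Context (R : realType).

Definition LMHV_brk (x y : LMHV_basis) : {malg R[i][LMHV_basis]} :=
  match x, y with
  | LMHV_L m i, LMHV_L n j => << (m - n)%:~R *g LMHV_L (m + n) (i + j) >>
  | LMHV_L m i, LMHV_H a j => << - (a%:~R + 2^-1) *g LMHV_H (m + a) (i + j) >>
  | LMHV_H a i, LMHV_L m j => << a%:~R + 2^-1 *g LMHV_H (m + a) (i + j) >>
  | LMHV_H _ _, LMHV_H _ _ => 0
  end.

Definition ULMHV : Type := env LMHV_brk.
HB.instance Definition _ := GRing.Algebra.on ULMHV.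

Definition UL (m i : int) : ULMHV := env_inj LMHV_brk << LMHV_L m i >>.

Lemma UL_comm (m i n j : int) :
  UL m i * UL n j - UL n j * UL m i = (m - n)%:~R *: UL (m + n) (i + j).
Proof.
rewrite -env_injU -[X in env_inj _ X]/(LMHV_brk (LMHV_L m i) (LMHV_L n j)).
by rewrite -lie_bracketU -env_inj_bracket.
Qed.

Definition anticomm (x y : ULMHV) : ULMHV := x * y + y * x.

Definition Omega (l : nat) (k s : int) (alpha beta : int -> int) : ULMHV :=
  \sum_(i < l.+1) ((-1) ^+ i * 'C(l, i)%:R : R[i]) *:
    (UL (k - i%:Z) (alpha (k - i%:Z)) * UL (s + i%:Z) (beta (s + i%:Z))).

End LMHV.

Definition depends_on_sum (f g : int -> int) : Prop :=
  forall i j i' j' : int, i + j = i' + j' -> f i + g j = f i' + g j'.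

(* The family with (f + g)_{i + j} = f_i + g_j; see fam_addE. *)
Definition fam_add (f g : int -> int) : int -> int := fun k => f k + g 0.

Lemma fam_addE (f g : int -> int) : depends_on_sum f g ->
  forall i j : int, fam_add f g (i + j) = f i + g j.
Proof. by move=> fg i j; apply: fg; rewrite addr0. Qed.

(* Main.v *)
(* Put A_i = L_{i,alpha_i}, B_i = L_{i,beta_i}, C_i = L_{i,gamma_i} and
   E_i = L_{i,eta_i}, and let D_12 be the difference operator on functions of
   (a, b, c, e) in Z^4 along the step (-1, 1, 0, 0); similarly D_13, D_24, D_34.
   Both halves of the left-hand side come from the same operator
   D = D_12^m D_13^m D_24^n D_34^n, so the left-hand side is D applied to
   [A_a B_b, C_c E_e]_+ - [A_a C_c, B_b E_e]_+ at (k, s, q, p).  Modulo terms with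
   a factor [A, B], [A, C], [B, E] or [C, E], this expression is
   [A_a, E_e] [B_b, C_c].  Such terms vanish under D: for instance
   [A_a, B_b] = (a - b) L_{a+b,...} is killed by D_12^2.  There remains D applied to
   x y G(a + e, b + c), where x = a - e, y = b - c and G is a product of two
   generators.  D_12 D_13 and D_24 D_34 commute with the multiplication by y, act on
   G as (1 - T)^2 and (1 - T^-1)^2 for the shift T along (-1, 1), and the factor x
   contributes the derivative of these operators. *)
Require Import Defs.
From HB Require Import structures.
From Stdlib Require List.
From mathcomp Require Import all_boot all_order all_algebra.
From mathcomp Require Import reals complex.
From mathcomp Require Import boolp functions ring zify.

Import GRing.Theory.
Local Open Scope ring_scope.

(** * Iterated differences of functions on an abelian group *)

Section Difference.
Context {G V : zmodType}.
Implicit Types (v w x : G) (F H : G -> V).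

Definition diff v F : G -> V := fun x => F x - F (x + v).

Lemma diffE v F x : diff v F x = F x - F (x + v).
Proof. by []. Qed.

Lemma diff_is_zmod_morphism v : zmod_morphism (diff v).
Proof.
move=> F H; apply/funext => x; rewrite /diff.
rewrite -[LHS]/(F x - H x - (F (x + v) - H (x + v))).
rewrite -[RHS]/(F x - F (x + v) - (H x - H (x + v))).
by rewrite !opprD !opprK addrACA.
Qed.

HB.instance Definition _ v :=
  GRing.isZmodMorphism.Build (G -> V) (G -> V) (diff v)
    (diff_is_zmod_morphism v).

Lemma iter_diff_is_zmod_morphism n v : zmod_morphism (iter n (diff v)).
Proof. by elim: n => // n IHn F H; rewrite !iterS IHn raddfB. Qed.

HB.instance Definition _ n v :=
  GRing.isZmodMorphism.Build (G -> V) (G -> V) (iter n (diff v))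
    (iter_diff_is_zmod_morphism n v).

Lemma diffC v w F : diff v (diff w F) = diff w (diff v F).
Proof.
by apply/funext => x; rewrite /diff [x + v + w]addrAC !opprD !opprK addrACA.
Qed.

Lemma iter_diffC m n v w F :
  iter m (diff v) (iter n (diff w) F) = iter n (diff w) (iter m (diff v) F).
Proof.
elim: m => //= m ->; elim: n => //= n IHn.
by rewrite diffC IHn.
Qed.

Lemma iter_diff_eq0 n v F :
  (2 <= n)%N -> diff v (diff v F) = 0 -> iter n (diff v) F = 0.
Proof.
by case: n => [|[|n]] // _ F0; rewrite !iterSr F0 raddf0.
Qed.

Lemma iter_diff_comp n v F (t : G) x :
  iter n (diff v) (fun y => F (y + t)) x = iter n (diff v) F (x + t).
Proof.
by elim: n x => //= n IHn x; rewrite /diff !IHn addrAC.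
Qed.

(* As operators, [1 - s^-1 = - s^-1 (1 - s)]. *)
Lemma iter_diffN n v F x :
  iter n (diff (- v)) F x = iter n (diff v) F (x - v *+ n) *~ (-1) ^+ n.
Proof.
elim: n x => [|n IHn] x; first by rewrite mulr0n subr0.
rewrite [LHS]/= diffE !IHn exprS mulN1r mulrNz iterS diffE -mulrzBl.
rewrite -mulNrz opprB mulrSr opprD addrA subrK.
by rewrite [x - v *+ n - v]addrAC.
Qed.

(** Along [v] the factor [H] is constant and [l] is affine, so the product is affine and its second
    difference is zero. *)
Lemma diff2_eq0 v (l : G -> int) (c : int) H :
  (forall x, H (x + v) = H x) -> (forall x, l (x + v) = l x + c) ->
  diff v (diff v (fun x => H x *~ l x)) = 0.
Proof.
move=> Hv lv; apply/funext => x.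
have subD (a b : V) : a - (a + b) = - b by rewrite opprD addNKr.
by rewrite !diffE !Hv !lv !mulrzDr !subD addrN.
Qed.

Lemma iter_diff_diffN m n v F x :
  iter m (diff v) (iter n (diff (- v)) F) x =
  iter (m + n) (diff v) F (x - v *+ n) *~ (-1) ^+ n.
Proof. by rewrite iter_diffC iter_diffN addnC iterD. Qed.

End Difference.

(** As [diff v] is 1 - T for the shift T by [v], this is the binomial theorem; the induction step is
    Pascal's rule. *)
Lemma iter_diffE (K : comNzRingType) (V : lmodType K) (G : zmodType)
    (n : nat) (v : G) (F : G -> V) x :
  iter n (diff v) F x =
  \sum_(i < n.+1) ((-1) ^+ i * 'C(n, i)%:R : K) *: F (x + v *+ i).
Proof.
elim: n x => [|n IHn] x.
  by rewrite big_ord1 mulr0n addr0 bin0 mulr1 scale1r.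
rewrite iterS /diff !IHn [RHS]big_ord_recl /=.
rewrite [X in X - _]big_ord_recl /= !bin0 -addrA; congr (_ + _).
under [in RHS]eq_bigr => i _.
  rewrite /bump /= add1n binS natrD mulrDr scalerDl.
  over.
rewrite big_split /= [in RHS]big_ord_recr /= bin_small // mulr0 scale0r addr0.
congr (_ + _); rewrite -sumrN; apply: eq_bigr => i _.
by rewrite exprS mulN1r mulNr scaleNr mulrS addrA.
Qed.

Lemma iter_diff2E (K : comNzRingType) (V : lmodType K) (G : zmodType)
    (m n : nat) (v w : G) (F : G -> V) x :
  iter m (diff v) (iter n (diff w) F) x =
  \sum_(i < m.+1) \sum_(j < n.+1)
    ((-1) ^+ (i + j) * 'C(m, i)%:R * 'C(n, j)%:R : K) *:
      F (x + v *+ i + w *+ j).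
Proof.
rewrite iter_diffE; apply: eq_bigr => i _.
rewrite iter_diffE scaler_sumr; apply: eq_bigr => j _.
by rewrite scalerA exprD mulrACA mulrA.
Qed.

(** * A Leibniz rule for paired differences *)

Section Leibniz.
Context {G T V : zmodType} (X Y : G -> int) (P : G -> T).
Context (v w : G) (t : T) (c : int).
Hypothesis Xv : forall z, X (z + v) = X z - 1.
Hypothesis Xw : forall z, X (z + w) = X z - 1.
Hypothesis Yv : forall z, Y (z + v) = Y z + c.
Hypothesis Yw : forall z, Y (z + w) = Y z - c.
Hypothesis Pv : forall z, P (z + v) = P z + t.
Hypothesis Pw : forall z, P (z + w) = P z + t.

(** The slot [h] collects the terms in which the factor [X] has been differenced, so that this shape
    is stable under a pair of differences. *)
Definition bilinear_lift (g h : T -> V) : G -> V :=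
  fun z => (g (P z) *~ X z + h (P z)) *~ Y z.

(** [X] and [P] move alike along [v] and [w], so the cofactor of [Y] is the same at z + v and z + w;
    there the increments c and -c of [Y] cancel, and [Y] factors out. What remains is a second
    difference along [t], in which [X], of slope -1, yields the extra term. *)
Lemma diff2_bilinear_lift (g h : T -> V) :
  diff v (diff w (bilinear_lift g h)) =
  bilinear_lift (diff t (diff t g))
    (fun y => diff t (diff t h) y + diff t g (y + t) *+ 2).
Proof.
apply/funext => z; rewrite !diffE /bilinear_lift !diffE !(Xv, Xw, Yv, Yw, Pv, Pw).
set x := X z; set y := Y z; set u := P z.
have E (p0 p1 p2 : V) :
    p0 *~ y - p1 *~ (y - c) - (p1 *~ (y + c) - p2 *~ (y + c - c)) =
    (p0 - p1 - (p1 - p2)) *~ y.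
  rewrite addrK mulrzBr mulrzDr !mulrzBl !opprD !opprK !addrA.
  by rewrite [LHS](ACl (1*2*4*6*(3*5))) /= addrN addr0.
have subDD (a b a' b' : V) : a + b - (a' + b') = a - a' + (b - b').
  by rewrite opprD addrACA.
rewrite E (subDD _ (h u)) (subDD _ (h (u + t))) (subDD _ (h u - _)).
rewrite [X in _ = (_ + X) *~ _]addrC [in RHS]addrA; congr ((_ + _) *~ _).
rewrite !mulrzBr !mulr1z !mulrzBl mulr2n !opprD !opprK !addrA.
by rewrite [LHS](ACl (1*2*4*6*3*7*5*8)).
Qed.

Lemma iter_diff_bilinear_lift m (g h : T -> V) :
  iter m (diff v) (iter m (diff w) (bilinear_lift g h)) =
  bilinear_lift (iter m.*2 (diff t) g)
    (fun y => iter m.*2 (diff t) h y +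
              iter m.*2.-1 (diff t) g (y + t) *+ m.*2).
Proof.
have diff_shift (f k : T -> V) j :
    diff t (fun y => f y + k (y + t) *+ j) =
    (fun y => diff t f y + diff t k (y + t) *+ j).
  by apply/funext => y; rewrite !diffE opprD addrACA mulrnBl.
elim: m => [|m IHm].
  by congr bilinear_lift; apply/funext => y; rewrite mulr0n addr0.
rewrite 2!iterS -[diff w _]/(iter 1 (diff w) _) iter_diffC [iter 1 _ _]/= IHm.
rewrite diff2_bilinear_lift !diff_shift doubleS !iterS; congr bilinear_lift.
apply/funext => y.
rewrite -addrA; congr (_ + _).
(* For m = 0 the order [m.*2.-1] is truncated, but its coefficient is 0. *)
case: m {IHm} => [|m]; first by rewrite mulr0n add0r.
by rewrite doubleS -[RHS]/(_ *+ (2 + _)) mulrnDr addrC.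
Qed.

End Leibniz.

(** * Four commuting differences on index quadruples *)

Notation index4 := (int * int * int * int)%type.
Notation step12 := ((-1, 1, 0, 0) : index4).
Notation step13 := ((-1, 0, 1, 0) : index4).
Notation step24 := ((0, -1, 0, 1) : index4).
Notation step34 := ((0, 0, -1, 1) : index4).
Notation step := ((-1, 1) : int * int).

Lemma mulrn_pair (G H : zmodType) (a : G) (b : H) n :
  (a, b) *+ n = (a *+ n, b *+ n).
Proof. by elim: n => // n IHn; rewrite mulrS IHn !mulrS. Qed.

Section FourDifferences.
Context {V : zmodType}.
Implicit Types (F H : index4 -> V).

Definition diff4 (m n : nat) F : index4 -> V :=
  iter m (diff step12) (iter m (diff step13)
    (iter n (diff step24) (iter n (diff step34) F))).

Lemma diff4_is_zmod_morphism m n : zmod_morphism (diff4 m n).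
Proof. by move=> F H; rewrite /diff4 !raddfB. Qed.

HB.instance Definition _ m n :=
  GRing.isZmodMorphism.Build (index4 -> V) (index4 -> V) (diff4 m n)
    (diff4_is_zmod_morphism m n).

(** The four differences commute, so the one along [v] can be applied first, and its exponent is at
    least 2. *)
Lemma diff4_eq0 m n v F : (2 <= m)%N -> (2 <= n)%N ->
  v \in [:: step12; step13; step24; step34] ->
  diff v (diff v F) = 0 -> diff4 m n F = 0.
Proof.
move=> m2 n2; rewrite !inE /diff4 => /or4P[] /eqP-> F0.
- rewrite [iter n (diff step24) _]iter_diffC 2![iter m (diff step13) _]iter_diffC.
  rewrite 3![iter m (diff step12) _]iter_diffC.
  by rewrite (iter_diff_eq0 _ _ _ m2 F0) !raddf0.
- rewrite 2![iter m (diff step13) _]iter_diffC.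
  by rewrite (iter_diff_eq0 _ _ _ m2 F0) !raddf0.
- by rewrite [iter n _ _]iter_diffC (iter_diff_eq0 _ _ _ n2 F0) !raddf0.
- by rewrite (iter_diff_eq0 _ _ _ n2 F0) !raddf0.
Qed.

(** Each pair of differences leaves one Leibniz term of order N: the pair [step24], [step34] gives
    the coefficient 2n at (u, v), the pair [step12], [step13] gives 2m at (u - 1, v + 1). The term
    that keeps the factor k - p has order N + 1. *)
Lemma diff4_bilinear_lift (g : int * int -> V) (m n : nat) (k s q p : int) :
  (0 < m)%N -> (0 < n)%N ->
  let N := (2 * (m + n) - 1)%N in
  let u := k + p + (2 * n)%:Z in
  let v := s + q - (2 * n)%:Z in
  diff4 m n (bilinear_lift (fun x => x.1.1.1 - x.2) (fun x => x.1.1.2 - x.1.2)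
                  (fun x => (x.1.1.1 + x.2, x.1.1.2 + x.1.2))
                  g (fun=> 0)) (k, s, q, p) =
  (iter N (diff step) g (u, v) *~ (p - k + (2 * n)%:Z) -
   iter N (diff step) g (u - 1, v + 1) *~ (p - k + (2 * m)%:Z)) *~ (q - s).
Proof.
move=> m0 n0 N u v.
rewrite /diff4 (@iter_diff_bilinear_lift _ _ _ _ _ _ step24 step34 (- step) (-1));
  do ?[by move=> x /=; ring
      |by move=> x; rewrite [RHS]surjective_pairing /=; congr (_, _); ring].
rewrite (@iter_diff_bilinear_lift _ _ _ _ _ _ step12 step13 step 1);
  do ?[by move=> x /=; ring
      |by move=> x; rewrite [RHS]surjective_pairing /=; congr (_, _); ring].
have stepE j : step *+ j = (- j%:Z, j%:Z) by rewrite mulrn_pair mulNrn natz.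
have m2 : (m.*2 = m.*2.-1.+1)%N by rewrite prednK ?double_gt0.
have n2 : (n.*2 = n.*2.-1.+1)%N by rewrite prednK ?double_gt0.
have NE : (m.*2.-1 + n.*2 = N)%N by rewrite /N; lia.
have even_sign : (-1) ^+ n.*2 = 1%R :> int by rewrite -muln2 exprM sqrr_sign.
have odd_sign : (-1) ^+ n.*2.-1 = (-1)%R :> int.
  by move: even_sign; rewrite n2 exprS mulN1r => /(canRL opprK).
(* Since [h] starts at 0, the first pair leaves only its Leibniz term in that slot. *)
rewrite /bilinear_lift [fun y => _ + _](_ : _ =
  (fun y => iter n.*2.-1 (diff (- step)) g (y + - step)) *+ n.*2); last first.
  apply/funext => y.
  rewrite -[iter _ _ _ in LHS]/(iter n.*2 (diff (- step)) 0) raddf0.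
  by rewrite natmulfctE add0r.
rewrite raddfMn natmulfctE /= iter_diff_comp !iter_diff_diffN even_sign odd_sign.
rewrite !mulr1z NE (_ : (m.*2 + n.*2.-1 = N)%N); last by rewrite /N; lia.
(* The term of order N + 1 is split into two values of the N-th difference, which merge with the
   Leibniz terms. *)
rewrite (_ : (m.*2 + n.*2 = N.+1)%N); last by rewrite /N; lia.
rewrite iterS diffE /=.
rewrite [_ + step - _]addrAC.
have -> : (k + p, s + q) - step - step *+ n.*2.-1 = (u, v).
  rewrite -addrA -opprD -mulrS -n2 stepE [LHS]surjective_pairing /= /u /v.
  by congr (_, _); lia.
have -> : (k + p, s + q) - step *+ n.*2 = (u, v).
  rewrite stepE [LHS]surjective_pairing /= /u /v.
  by congr (_, _); lia.
rewrite -[(u, v) + step]/(u - 1, v + 1).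
set a := iter N _ _ (u, v); set b := iter N _ _ _.
(* The factor [Y] is s - q at this point, whence the change of sign. *)
rewrite -[q - s]opprB [RHS]mulrNz -[RHS]mulNrz; congr (_ *~ _).
rewrite mulrN1z !pmulrn mulNrz !mul2n mulrzBl !mulrzDr !mulrNz !opprD !opprK !addrA.
by rewrite [LHS](ACl (2*1*5*4*3*6)).
Qed.

End FourDifferences.

(** * Reduction to [A, E][B, C] by means of the brackets *)

Section Reduction.
Context {Alg : nzRingType} (A B C E AB AC AE BC BE CE : int -> Alg).

Definition witt_bracket (X Y Z : int -> Alg) : Prop :=
  forall i j, X i * Y j - Y j * X i = Z (i + j) *~ (i - j).

Hypothesis brAB : witt_bracket A B AB.
Hypothesis brAC : witt_bracket A C AC.
Hypothesis brAE : witt_bracket A E AE.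
Hypothesis brBC : witt_bracket B C BC.
Hypothesis brBE : witt_bracket B E BE.
Hypothesis brCE : witt_bracket C E CE.

Definition quartic (x : index4) : Alg :=
  let: (a, b, c, e) := x in
  (A a * B b * (C c * E e) + C c * E e * (A a * B b)) -
  (A a * C c * (B b * E e) + B b * E e * (A a * C c)).

(** Each of the eight error terms exchanges two adjacent factors of a monomial, through a bracket of
    A with B, A with C, B with E or C with E. *)
Lemma quarticE :
  quartic =
  bilinear_lift (fun x => x.1.1.1 - x.2) (fun x => x.1.1.2 - x.1.2)
       (fun x => (x.1.1.1 + x.2, x.1.1.2 + x.1.2))
       (fun z => AE z.1 * BC z.2) (fun=> 0)
  + ((fun x => A x.1.1.1 * B x.1.1.2 * CE (x.1.2 + x.2) *~ (x.1.2 - x.2))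
   + (fun x => A x.1.1.1 * BE (x.1.1.2 + x.2) * C x.1.2 *~ (x.1.1.2 - x.2))
   - (fun x => E x.2 * AC (x.1.1.1 + x.1.2) * B x.1.1.2 *~ (x.1.1.1 - x.1.2))
   + (fun x => CE (x.1.2 + x.2) * A x.1.1.1 * B x.1.1.2 *~ (x.1.2 - x.2))
   - (fun x => A x.1.1.1 * C x.1.2 * BE (x.1.1.2 + x.2) *~ (x.1.1.2 - x.2))
   - (fun x => A x.1.1.1 * CE (x.1.2 + x.2) * B x.1.1.2 *~ (x.1.2 - x.2))
   + (fun x => E x.2 * AB (x.1.1.1 + x.1.1.2) * C x.1.2 *~ (x.1.1.1 - x.1.1.2))
   - (fun x => BE (x.1.1.2 + x.2) * A x.1.1.1 * C x.1.2 *~ (x.1.1.2 - x.2))).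
Proof.
apply/funext => -[[[a b] c] e].
rewrite -[RHS]/(((AE (a + e) * BC (b + c)) *~ (a - e) + 0) *~ (b - c) +
  (A a * B b * CE (c + e) *~ (c - e)
   + A a * BE (b + e) * C c *~ (b - e)
   - E e * AC (a + c) * B b *~ (a - c)
   + CE (c + e) * A a * B b *~ (c - e)
   - A a * C c * BE (b + e) *~ (b - e)
   - A a * CE (c + e) * B b *~ (c - e)
   + E e * AB (a + b) * C c *~ (a - b)
   - BE (b + e) * A a * C c *~ (b - e))).
(* Every integer multiple is moved onto its bracket family, so that the bracket relations can be
   read backwards. *)
rewrite addr0 -[_ *~ (a - e)]mulrzAl -[_ *~ (b - c)]mulrzAr.
rewrite -[A a * B b * CE _ *~ _]mulrzAr -[CE _ * A a * B b *~ _]mulrzAl.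
rewrite -[CE _ * A a *~ _]mulrzAl -[A a * CE _ * B b *~ _]mulrzAl.
rewrite -[A a * CE _ *~ _]mulrzAr -[A a * C c * BE _ *~ _]mulrzAr.
rewrite -[BE _ * A a * C c *~ _]mulrzAl -[BE _ * A a *~ _]mulrzAl.
rewrite -[A a * BE _ * C c *~ _]mulrzAl -[A a * BE _ *~ _]mulrzAr.
rewrite -[E e * AC _ * B b *~ _]mulrzAl -[E e * AC _ *~ _]mulrzAr.
rewrite -[E e * AB _ * C c *~ _]mulrzAl -[E e * AB _ *~ _]mulrzAr.
rewrite -!(brAB, brAC, brAE, brBC, brBE, brCE) /quartic.
move: (A a) (B b) (C c) (E e) => {}a {}b {}c {}e.
rewrite !mulrBr !mulrBl !mulrA ?mulrBl !opprD !opprK !addrA.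
(* Monomials 5, 11, 13 and 19 are those of [quartic]; the other sixteen cancel in eight pairs. *)
rewrite [RHS](ACl (5*11*13*19*
  (1*8)*(17*2)*(16*3)*(4*9)*(7*6)*(10*12)*(14*15)*(20*18))).
by rewrite /= !subrr !addr0.
Qed.

Lemma step_sum (x y : int) : x - 1 + (y + 1) = x + y.
Proof. ring. Qed.

Local Ltac vanish d0 v :=
  rewrite (d0 v);
  [|by []|by move=> x /=; rewrite ?step_sum ?addr0|by move=> x /=; ring].

Lemma diff4_quartic m n : (2 <= m)%N -> (2 <= n)%N ->
  diff4 m n quartic =
  diff4 m n (bilinear_lift (fun x => x.1.1.1 - x.2) (fun x => x.1.1.2 - x.1.2)
    (fun x => (x.1.1.1 + x.2, x.1.1.2 + x.1.2))
    (fun z => AE z.1 * BC z.2) (fun=> 0)).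
Proof.
move=> m2 n2.
have d0 v (l : index4 -> int) (H : index4 -> Alg) :
    v \in [:: step12; step13; step24; step34] ->
    (forall x, H (x + v) = H x) -> (forall x, l (x + v) = l x - 2) ->
    diff4 m n (fun x => H x *~ l x) = 0.
  by move=> v_in Hv lv; apply: diff4_eq0 v_in _ => //; apply: diff2_eq0 Hv lv.
rewrite quarticE !(raddfD, raddfN) -[RHS]addr0 /=; congr (_ + _).
(* The step that succeeds joins the two indices of the bracket factor: it fixes their sum and lowers
   their difference by 2. *)
do 8?[vanish d0 constr:(step12) | vanish d0 constr:(step13)
     |vanish d0 constr:(step24) | vanish d0 constr:(step34)].
by rewrite ?oppr0 !addr0.
Qed.

Lemma diff4_quarticE m n (k s q p : int) : (2 <= m)%N -> (2 <= n)%N ->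
  let N := (2 * (m + n) - 1)%N in
  let F := iter N (diff step) (fun z => AE z.1 * BC z.2) in
  let u := k + p + (2 * n)%:Z in
  let v := s + q - (2 * n)%:Z in
  diff4 m n quartic (k, s, q, p) =
  (F (u, v) *~ (p - k + (2 * n)%:Z) -
   F (u - 1, v + 1) *~ (p - k + (2 * m)%:Z)) *~ (q - s).
Proof.
by move=> m2 n2 /=; rewrite diff4_quartic // diff4_bilinear_lift // ltnW.
Qed.

End Reduction.

(** * From [Omega] to differences of products of generators *)

Section Omega.
Context {R : realType}.

Lemma OmegaE l k s (f g : int -> int) :
  Omega R l k s f g =
  iter l (diff step)
    (fun z => UL R z.1 (f z.1) * UL R z.2 (g z.2)) (k, s).
Proof.
rewrite (iter_diffE R[i]); apply: eq_bigr => i _.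
by rewrite mulrn_pair mulNrn natz.
Qed.

(** Bracketing adds the loop indices; as f_i + g_j depends only on i + j, the result lies in a
    single family again. *)
Lemma UL_witt_bracket (f g : int -> int) : depends_on_sum f g ->
  witt_bracket (fun i => UL R i (f i)) (fun i => UL R i (g i))
    (fun i => UL R i (fam_add f g i)).
Proof. by move=> fg i j; rewrite UL_comm scaler_int fam_addE. Qed.

Lemma anticomm_Omega m n k s q p (f1 f2 f3 f4 : int -> int) :
  anticomm (Omega R m k s f1 f2) (Omega R n q p f3 f4) =
  \sum_(i < m.+1) \sum_(j < n.+1)
    ((-1) ^+ (i + j) * 'C(m, i)%:R * 'C(n, j)%:R : R[i]) *:
    anticomm (UL R (k - i%:Z) (f1 (k - i%:Z)) * UL R (s + i%:Z) (f2 (s + i%:Z)))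
             (UL R (q - j%:Z) (f3 (q - j%:Z)) * UL R (p + j%:Z) (f4 (p + j%:Z))).
Proof.
rewrite /anticomm [Omega R m _ _ _ _]/Omega mulr_suml mulr_sumr -big_split.
apply: eq_bigr => i _ /=; rewrite /Omega mulr_suml mulr_sumr -big_split.
apply: eq_bigr => j _ /=.
rewrite -2![in LHS]scalerAl -2![in LHS]scalerAr !scalerA.
by rewrite [X in _ + X *: _]mulrC -scalerDr mulrACA -exprD mulrA.
Qed.

End Omega.

Theorem theorem3p7 (R : realType) (k s p q : int)
    (alpha beta gamma eta : int -> int)
    (Hsum : forall f g : int -> int,
      List.In f [:: alpha; beta; gamma; eta] ->
      List.In g [:: alpha; beta; gamma; eta] -> depends_on_sum f g)
    (m n : nat) (Hm : (2 <= m)%N) (Hn : (2 <= n)%N) :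
  \sum_(i < m.+1) \sum_(j < n.+1)
    ((-1) ^+ (i + j) * 'C(m, i)%:R * 'C(n, j)%:R : R[i]) *:
      (anticomm (Omega R m (k - i%:Z) (s - j%:Z) alpha beta)
                (Omega R n (q + i%:Z) (p + j%:Z) gamma eta)
       - anticomm (Omega R m (k - i%:Z) (q - j%:Z) alpha gamma)
                  (Omega R n (s + i%:Z) (p + j%:Z) beta eta))
  = (q - s)%:~R *:
      ((p - k + (2 * n)%:Z)%:~R *:
         Omega R (2 * (m + n) - 1)%N (k + p + (2 * n)%:Z)
           (s + q - (2 * n)%:Z) (fam_add alpha eta) (fam_add beta gamma)
       - (p - k + (2 * m)%:Z)%:~R *:
         Omega R (2 * (m + n) - 1)%N (k + p + (2 * n)%:Z - 1)
           (s + q - (2 * n)%:Z + 1) (fam_add alpha eta) (fam_add beta gamma)).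
Proof.
have br f g : List.In f [:: alpha; beta; gamma; eta] ->
    List.In g [:: alpha; beta; gamma; eta] ->
    witt_bracket (fun i => UL R i (f i)) (fun i => UL R i (g i))
      (fun i => UL R i (fam_add f g i)).
  by move=> f_in g_in; apply/UL_witt_bracket/Hsum.
have ina : List.In alpha [:: alpha; beta; gamma; eta] by left.
have inb : List.In beta [:: alpha; beta; gamma; eta] by right; left.
have inc : List.In gamma [:: alpha; beta; gamma; eta] by do 2 right; left.
have ine : List.In eta [:: alpha; beta; gamma; eta] by do 3 right; left.
rewrite !scaler_int !OmegaE.
(* The right-hand side is folded back into the fourfold difference of [quartic] at (k, s, q, p). *)
rewrite -(diff4_quarticE _ _ _ _ _ _ _ _ _ _ (br _ _ ina inb)
  (br _ _ ina inc) (br _ _ ina ine) (br _ _ inb inc) (br _ _ inb ine)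
  (br _ _ inc ine)) //.
set A := fun i => UL R i (alpha i). set B := fun i => UL R i (beta i).
set C := fun i => UL R i (gamma i). set E := fun i => UL R i (eta i).
pose Q1 (x : index4) := anticomm (A x.1.1.1 * B x.1.1.2) (C x.1.2 * E x.2).
pose Q2 (x : index4) := anticomm (A x.1.1.1 * C x.1.2) (B x.1.1.2 * E x.2).
have -> : quartic A B C E = Q1 - Q2 by apply/funext => -[[[a b] c] e].
rewrite raddfB -[RHS]/(diff4 m n Q1 _ - diff4 m n Q2 _).
under eq_bigr => i _.
  under eq_bigr => j _ do rewrite scalerBr.
  rewrite sumrB; over.
rewrite sumrB; congr (_ - _).
  (* In this half the outer sums come from [step13] and [step24], while [step12] and [step34] build
     the two [Omega]. *)
  rewrite /diff4 iter_diffC [iter m (diff step12) _]iter_diffC (iter_diff2E R[i]).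
  apply: eq_bigr => i _; apply: eq_bigr => j _; congr (_ *: _).
  rewrite anticomm_Omega (iter_diff2E R[i]).
  apply: eq_bigr => a _; apply: eq_bigr => b _; congr (_ *: _).
  by rewrite /Q1 /A /B /C /E !mulrn_pair !mul0rn !mulNrn !natz /= !addr0.
(* Here the roles are exchanged: [step12] and [step34] give the outer sums, [step13] and [step24]
   the two [Omega]. *)
rewrite /diff4 [iter n (diff step24) _]iter_diffC.
rewrite [iter m (diff step13) _]iter_diffC (iter_diff2E R[i]).
apply: eq_bigr => i _; apply: eq_bigr => j _; congr (_ *: _).
rewrite anticomm_Omega (iter_diff2E R[i]).
apply: eq_bigr => a _; apply: eq_bigr => b _; congr (_ *: _).
by rewrite /Q2 /A /B /C /E !mulrn_pair !mul0rn !mulNrn !natz /= !addr0.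
Qed.
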